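(* Let $\mathrm{pnt}(K_{N,N})$ denote the paint number of the complete bipartite graph $K_{N,N}$ with $N$ vertices in each part. Then, as $N \to \infty$, $$\mathrm{pnt}(K_{N,N}) = \log N + O(1),$$ where $\log$ is the logarithm to base $2$.
   Context: On-line list coloring game. Given a finite graph $G=(V,E)$ and a function $f:V\to\mathbb{N}$, two players, Lister and Painter, play in rounds. In the $i$-th round Lister presents a nonempty set of vertices $V_i \subseteq V\setminus\bigcup_{j=1}^{i-1}X_j$, and Painter chooses $X_i \subseteq V_i$ that is an independent set in $G$. After $i$ rounds, the vertices in $\bigcup_{j=1}^{i}X_j$ are called colored. If a vertex $v$ belongs to exactly $l$ of the sets $V_1,\ldots,V_i$, we say $v$ has $l$ permissible colors after $i$ rounds. Lister wins if after some round there exists an uncolored vertex $v$ with $f(v)$ permissible colors. If this never happens, then eventually all vertices are colored and Painter wins. The graph $G$ is $f$-paintable if Painter has a winning strategy, and $k$-paintable if it is $f$-paintable for the constant function $f(x)=k$. The smallest $k$ such that $G$ is $k$-paintable is the paint number of $G$, denoted $\mathrm{pnt}(G)$. *)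

(* Defs.v *)
From mathcomp Require Import all_boot.
From mathcomp Require Import boolp.

Set Implicit Arguments.
Unset Strict Implicit.
Unset Printing Implicit Defensive.

Record sgraph := SGraph {
  vertex :> finType;
  adj : rel vertex;
  adj_sym : symmetric adj;
  adj_irrefl : irreflexive adj
}.

Section OnlineGame.
Variable G : sgraph.
Implicit Types (A V : {set G}) (Vs : seq {set G}) (v : G) (f : G -> nat).

Definition independent A : Prop := {in A &, forall u v, ~~ adj u v}.

(* Lister's moves so far, in order and including the current one, are mapped to
   the set chosen by Painter in the current round.  Painter's earlier choices
   are the values of the strategy at the shorter prefixes, so they are not
   recorded in the history. *)
Definition strategy := seq {set G} -> {set G}.

Implicit Types S : strategy.

(* Round i (counted from 0) of the play in which Lister presents Vs. *)
Definition reply S Vs (i : nat) : {set G} := S (take i.+1 Vs).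

Definition colored S Vs : {set G} := \bigcup_(i < size Vs) reply S Vs i.

Definition permissible Vs v : nat := count (fun V => v \in V) Vs.

Definition lister_legal S Vs : Prop := forall i, i < size Vs ->
  nth set0 Vs i != set0 /\ nth set0 Vs i \subset ~: colored S (take i Vs).

Definition painter_legal S Vs : Prop := forall i, i < size Vs ->
  reply S Vs i \subset nth set0 Vs i /\ independent (reply S Vs i).

Definition lister_wins f S Vs : Prop :=
  0 < size Vs /\ exists2 v, v \notin colored S Vs & permissible Vs v = f v.

(* Every finite play is covered, since Vs ranges over all finite sequences:
   Lister's condition must fail after each round of each play against S. *)
Definition winning f S : Prop := forall Vs, lister_legal S Vs ->
  painter_legal S Vs /\ ~ lister_wins f S Vs.

Definition fpaintable f : Prop := exists S, winning f S.

Definition paintable (k : nat) : Prop := fpaintable (fun=> k).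

Lemma lister_legal_rcons S Vs V : lister_legal S (rcons Vs V) ->
  [/\ lister_legal S Vs, V != set0 & V \subset ~: colored S Vs].
Proof.
move=> leg; split.
- move=> i lti; have := leg i; rewrite size_rcons ltnS (ltnW lti) => /(_ isT).
  by rewrite nth_rcons lti -cats1 takel_cat // ltnW.
- have := leg (size Vs); rewrite size_rcons ltnSn => /(_ isT) [].
  by rewrite nth_rcons ltnn eqxx.
- have := leg (size Vs); rewrite size_rcons ltnSn => /(_ isT) [_].
  by rewrite nth_rcons ltnn eqxx -cats1 take_size_cat.
Qed.

Lemma colored_rcons S Vs V :
  colored S (rcons Vs V) = colored S Vs :|: S (rcons Vs V).
Proof.
rewrite /colored /reply size_rcons big_ord_recr /= -(size_rcons Vs V) take_size.
congr (_ :|: _); apply: eq_bigr => i _.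
by rewrite -cats1 takel_cat // ltn_ord.
Qed.

Definition one_vertex : strategy := fun Vs =>
  if [pick v in last set0 Vs] is Some v then [set v] else set0.

Lemma one_vertex_colored Vs :
  lister_legal one_vertex Vs -> size Vs <= #|colored one_vertex Vs|.
Proof.
elim/last_ind: Vs => [//|Vs V IH] /lister_legal_rcons [leg V0 sV].
rewrite colored_rcons size_rcons {2}/one_vertex last_rcons.
case: pickP => [v vV|V00].
  rewrite setUC cardsU1; have := subsetP sV v vV.
  by rewrite inE => ->; rewrite add1n ltnS IH.
by case/set0Pn: V0 => v; rewrite V00.
Qed.

Lemma paintable_ex : exists k, `[< paintable k >].
Proof.
exists #|G|; apply/asboolP; exists one_vertex => Vs leg; split; last first.
  case=> _ [v vNc pv].
  have lt : #|colored one_vertex Vs| < #|G|.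
    rewrite -cardsT; apply: proper_card; apply/properP; split; first exact: subsetT.
    by exists v; rewrite ?inE.
  have := leq_trans (count_size (fun V => v \in V) Vs) (one_vertex_colored leg).
  by rewrite -/(permissible Vs v) pv leqNgt lt.
move=> i lti; rewrite /reply /one_vertex (take_nth set0) // last_rcons.
case: pickP => [v vV|_]; split.
- by rewrite sub1set.
- by move=> u w; rewrite !inE => /eqP -> /eqP ->; rewrite adj_irrefl.
- exact: sub0set.
- by move=> u w; rewrite inE.
Qed.

Definition pnt : nat := ex_minn paintable_ex.

End OnlineGame.

Definition bip_adj (m n : nat) : rel ('I_m + 'I_n) := fun x y =>
  match x, y with
  | inl _, inr _ | inr _, inl _ => true
  | _, _ => false
  end.

Lemma bip_adj_sym m n : symmetric (@bip_adj m n).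
Proof. by case=> ? [?|?]. Qed.

Lemma bip_adj_irrefl m n : irreflexive (@bip_adj m n).
Proof. by case. Qed.

Definition complete_bipartite (m n : nat) : sgraph :=
  SGraph (@bip_adj_sym m n) (@bip_adj_irrefl m n).

(* Main.v *)
Require Import Defs.
From mathcomp Require Import all_boot all_order all_algebra.
From mathcomp Require Import all_classical all_reals all_analysis.
From mathcomp Require Import ring lra zify.
Import Order.TTheory GRing.Theory Num.Theory.
Import numFieldNormedType.Exports.

(** Upper bound: give an uncolored vertex with l permissible colors the weight
    2^l.  If Painter always colors the heavier side of the presented set, the
    total weight never exceeds its initial value 2N, so l <= log2 (2N).

    Lower bound: label every vertex by the number r of permissible colors it
    still lacks.  Lister maintains reals U, V, both initially k, and values a
    left vertex of label r at about (U / (U + V))^r and a right one at about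
    (V / (U + V))^r.  In a round with a small step m he presents a proportion
    r m / (U + V) of the vertices of each label r; if Painter colors on the
    right, U decreases by m, and otherwise V does.  To first order the powers
    (w / (U + V))^r of the left side are then conserved for every w of the form
    U + constant, whatever Painter answers.  Subtracting multiples of the powers
    with w = U - 4 and w = U + 4 makes the value negative unless r is of the
    order of U, so no single vertex of positive value is worth much, and the
    slow growth of the coefficient 1 + 1/U + 1/V pays for the second order terms
    and for rounding the proportions to actual sets.  So both sides keep a
    value at least K although N is only a constant times 2^k.  Once U (or V) is
    bounded, some label r <= 162 * 64 is carried by at least c^r left vertices,
    where c bounds the labels on the right, and an explicit strategy wins. *)

Set Implicit Arguments.
Unset Strict Implicit.
Unset Printing Implicit Defensive.

Local Open Scope ring_scope.

(** * The value of a vertex *)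

(** Convexity: the power lies above its tangent at [y]. The increment [d] may be negative, so powers
    at a lowered base are bounded from below as well. *)
Lemma exprD_ge_tangent (R : realDomainType) (y d : R) (n : nat) :
  0 <= y -> 0 <= y + d -> y ^+ n + n%:R * d * y ^+ n.-1 <= (y + d) ^+ n.
Proof.
move=> y0 yd0; elim: n => [|[|n] IH]; first by rewrite !expr0 mul0r mul0r addr0.
  by rewrite !expr1 expr0; lra.
rewrite [leRHS]exprS; apply: le_trans (ler_wpM2l yd0 IH).
rewrite /= !exprS -subr_ge0.
have -> : (y + d) * (y * y ^+ n + n.+1%:R * d * y ^+ n) -
    (y * (y * y ^+ n) + n.+2%:R * d * (y * y ^+ n)) = n.+1%:R * d ^+ 2 * y ^+ n.
  by rewrite -[n.+2%:R]natr1 -[n.+1%:R]natr1; ring.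
by apply: mulr_ge0; [apply: mulr_ge0; [exact: ler0n|exact: sqr_ge0]|exact: exprn_ge0].
Qed.

Lemma bernoulli_ge (R : realDomainType) (t : R) (n : nat) :
  -1 <= t -> 1 + n%:R * t <= (1 + t) ^+ n.
Proof.
move=> t1; have := @exprD_ge_tangent R 1 t n.
by rewrite !expr1n mulr1; apply; lra.
Qed.

Section Weight.
Variable R : realFieldType.
Implicit Types (U V K : R) (r : nat).

Definition eps : R := (8 * 162 ^+ 2)^-1.

(* Small enough for the second order losses, which are quadratic in the step, to
   stay below the gain step / V^2 of the coefficient 1 + 1/U + 1/V in [wt], and
   large enough for that gain to pay for one badly rounded vertex. *)
Definition step U V := eps * (U^-1 + V^-1) ^+ 2.

Definition chip_prob U V r := r%:R * step U V / (U + V).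

(* The constants 4, 4 and 1/324 are chosen so that a vertex of positive value has
   U / 8 <= r <= 162 U, while the value at U = V = k = r is still of order 2^-k. *)
Definition wt U V r := (1 + U^-1 + V^-1) * (U / (U + V)) ^+ r
  - 4 * ((U - 4) / (U + V)) ^+ r - 324^-1 * ((U + 4) / (U + V)) ^+ r.

Lemma eps_gt0 : 0 < eps. Proof. by rewrite invr_gt0; lra. Qed.

Lemma epsE : 8 * 162 ^+ 2 * eps = 1.
Proof. by rewrite mulfV // lt0r_neq0 //; lra. Qed.

Lemma stepC U V : step U V = step V U. Proof. by rewrite /step addrC. Qed.

(** Rounds are played only while [U] and [V] exceed 64, and each lowers one of them by at most 1, so
    the estimates are made from 63 on. *)
Lemma pos63 U V : 63 <= U -> 63 <= V -> [/\ 0 < U, 0 < V & 0 < U + V].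
Proof. by move=> hU hV; split; lra. Qed.

Lemma neq63 U V : 63 <= U -> 63 <= V -> [/\ U != 0, V != 0 & U + V != 0].
Proof. by move=> hU hV; split; apply: lt0r_neq0; lra. Qed.

Lemma inv_le63 (x : R) : 63 <= x -> 0 < x^-1 <= 63^-1.
Proof.
move=> hx; have x0 : 0 < x by lra.
by rewrite invr_gt0 x0 lef_pV2 ?posrE ?ltr0n.
Qed.

Lemma coef_bounds U V : 63 <= U -> 63 <= V -> 1 <= 1 + U^-1 + V^-1 <= 2.
Proof.
move=> hU hV; have [U0 V0 s0] := pos63 hU hV; have [Un0 Vn0 sn0] := neq63 hU hV.
have := inv_le63 hU; have := inv_le63 hV; lra. Qed.

Lemma step_gt0 U V : 63 <= U -> 63 <= V -> 0 < step U V.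
Proof.
move=> hU hV; have [U0 V0 s0] := pos63 hU hV; have [Un0 Vn0 sn0] := neq63 hU hV.
rewrite mulr_gt0 ?eps_gt0 // exprn_gt0 //.
by have := inv_le63 hU; have := inv_le63 hV; lra.
Qed.

Lemma step_le1 U V : 63 <= U -> 63 <= V -> step U V <= 1.
Proof.
move=> hU hV; have [U0 V0 s0] := pos63 hU hV; have [Un0 Vn0 sn0] := neq63 hU hV.
have := inv_le63 hU; have := inv_le63 hV; have := eps_gt0; have := epsE.
by rewrite /step; nra.
Qed.

Lemma step_ge U V : 63 <= U -> 63 <= V -> eps <= step U V * V ^+ 2.
Proof.
move=> hU hV; have [U0 V0 s0] := pos63 hU hV; have [Un0 Vn0 sn0] := neq63 hU hV.
rewrite /step -mulrA ler_peMr ?(ltW eps_gt0) // -exprMn.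
rewrite -[leLHS](expr1n R 2) ler_sqr ?nnegrE //; last first.
  by rewrite mulr_ge0 ?(ltW V0) // addr_ge0 // invr_ge0 ltW.
by rewrite mulrDl mulVf // lerDr mulr_ge0 ?invr_ge0 ?ltW.
Qed.

Lemma step_mulUV U V : 63 <= U -> 63 <= V ->
  step U V * (U * V) ^+ 2 = eps * (U + V) ^+ 2.
Proof.
move=> hU hV; have [U0 V0 s0] := pos63 hU hV; have [Un0 Vn0 sn0] := neq63 hU hV.
by rewrite /step; field; rewrite ?Un0 ?Vn0 ?sn0. Qed.

Lemma wt_le U V r : 63 <= U -> 63 <= V -> wt U V r <= 2 * (U / (U + V)) ^+ r.
Proof.
move=> hU hV; have [U0 V0 s0] := pos63 hU hV; have [Un0 Vn0 sn0] := neq63 hU hV.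
rewrite /wt; have /andP[_ c2] := coef_bounds hU hV.
have : 0 <= ((U - 4) / (U + V)) ^+ r by rewrite exprn_ge0 // divr_ge0; lra.
have : 0 <= ((U + 4) / (U + V)) ^+ r by rewrite exprn_ge0 // divr_ge0; lra.
have : 0 <= (U / (U + V)) ^+ r by rewrite exprn_ge0 // divr_ge0; lra.
nra.
Qed.

Lemma wtE U V r : 63 <= U -> 63 <= V -> wt U V r = (U / (U + V)) ^+ r *
  (1 + U^-1 + V^-1 - 4 * (1 - 4 / U) ^+ r - 324^-1 * (1 + 4 / U) ^+ r).
Proof.
move=> hU hV; have [U0 V0 s0] := pos63 hU hV; have [Un0 Vn0 sn0] := neq63 hU hV.
have e1 : (U - 4) / (U + V) = U / (U + V) * (1 - 4 / U) by field; rewrite ?Un0 ?Vn0 ?sn0.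
have e2 : (U + 4) / (U + V) = U / (U + V) * (1 + 4 / U) by field; rewrite ?Un0 ?Vn0 ?sn0.
by rewrite /wt e1 e2 !exprMn; ring.
Qed.

Lemma wt_gt0_coef U V r : 63 <= U -> 63 <= V -> 0 < wt U V r ->
  4 * (1 - 4 / U) ^+ r + 324^-1 * (1 + 4 / U) ^+ r < 2.
Proof.
move=> hU hV; have [U0 V0 s0] := pos63 hU hV; have [Un0 Vn0 sn0] := neq63 hU hV.
rewrite wtE // pmulr_rgt0; last by rewrite exprn_gt0 // divr_gt0.
by have := coef_bounds hU hV; lra.
Qed.

(** Bernoulli on the term with [U - 4] gives 4 (1 - 4 r / U) < 2. *)
Lemma wt_gt0_ge U V r : 63 <= U -> 63 <= V -> 0 < wt U V r -> U <= 8 * r%:R.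
Proof.
move=> hU hV; have [U0 V0 s0] := pos63 hU hV; have [Un0 Vn0 sn0] := neq63 hU hV.
move=> /(wt_gt0_coef hU hV) h.
have iU := inv_le63 hU.
have b1 : 1 + r%:R * (- (4 / U)) <= (1 + - (4 / U)) ^+ r.
  by apply: bernoulli_ge; lra.
have b2 : 0 <= (1 + 4 / U) ^+ r by rewrite exprn_ge0 //; lra.
have : 1 < 8 * (r%:R / U) by nra.
by rewrite mulrA ltr_pdivlMr // mul1r => /ltW.
Qed.

(** Bernoulli on the term with [U + 4] gives (1 + 4 r / U) / 324 < 2. *)
Lemma wt_gt0_le U V r : 63 <= U -> 63 <= V -> 0 < wt U V r -> r%:R <= 162 * U.
Proof.
move=> hU hV; have [U0 V0 s0] := pos63 hU hV; have [Un0 Vn0 sn0] := neq63 hU hV.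
move=> /(wt_gt0_coef hU hV) h.
have iU := inv_le63 hU.
have b1 : 1 + r%:R * (4 / U) <= (1 + 4 / U) ^+ r by apply: bernoulli_ge; lra.
have b2 : 0 <= (1 - 4 / U) ^+ r by rewrite exprn_ge0 //; lra.
have : r%:R / U <= 162 by nra.
by rewrite ler_pdivrMr.
Qed.

Lemma chip_prob_ge0 U V r : 63 <= U -> 63 <= V -> 0 <= chip_prob U V r.
Proof.
move=> hU hV; have [U0 V0 s0] := pos63 hU hV; have [Un0 Vn0 sn0] := neq63 hU hV.
apply: divr_ge0 (ltW s0); apply: mulr_ge0; first exact: ler0n.
exact/ltW/step_gt0.
Qed.

(** The choice of [eps] turns this into an equality at r = 162 U. *)
Lemma chip_prob_sq U V r : 63 <= U -> 63 <= V -> r%:R <= 162 * U ->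
  8 * chip_prob U V r ^+ 2 <= step U V / V ^+ 2.
Proof.
move=> hU hV; have [U0 V0 s0] := pos63 hU hV; have [Un0 Vn0 sn0] := neq63 hU hV.
move=> hr.
have -> : step U V / V ^+ 2 = 8 * (162 * U * step U V / (U + V)) ^+ 2.
  apply: (@mulIf _ (V ^+ 2 * (U + V) ^+ 2)); first by rewrite mulf_neq0 ?expf_neq0.
  transitivity (step U V * (U + V) ^+ 2 * (8 * 162 ^+ 2 * eps)).
    by rewrite epsE; field.
  transitivity (step U V * (8 * 162 ^+ 2) * (eps * (U + V) ^+ 2)); first by ring.
  by rewrite -(step_mulUV hU hV); field.
rewrite ler_pM2l ?ltr0n // ler_sqr ?nnegrE ?(chip_prob_ge0 _ hU hV) //.
  by rewrite /chip_prob !ler_pM2r ?(step_gt0 hU hV) ?invr_gt0.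
apply: divr_ge0 (ltW s0); apply: mulr_ge0; last exact/ltW/step_gt0.
by apply: mulr_ge0; [exact: ler0n|exact: ltW].
Qed.

Lemma chip_prob_lt1 U V r : 63 <= U -> 63 <= V -> r%:R <= 162 * U ->
  chip_prob U V r < 1.
Proof.
move=> hU hV; have [U0 V0 s0] := pos63 hU hV; have [Un0 Vn0 sn0] := neq63 hU hV.
move=> /(chip_prob_sq hU hV) h.
have := step_le1 hU hV; have := step_gt0 hU hV; have := chip_prob_ge0 r hU hV.
have : 0 < (V ^+ 2)^-1 <= 1.
  have := inv_le63 hV; rewrite -exprVn; nra.
nra.
Qed.


(** Painter colors the presented left vertices: a proportion 1 - p survives and [V] drops by [m].
    All powers grow by one factor [c ^+ r], and (1 - p) c^r >= 1 - p^2. The coefficient gains at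
    least m / V^2 from its term [V^-1]; second order losses take at most half of this, and the rest
    is left to pay for rounding. *)
Lemma wt_kill U V r (m := step U V) : 64 <= U -> 64 <= V -> 0 < wt U V r ->
  wt U V r + (U / (U + V)) ^+ r * (m / (2 * V ^+ 2))
    <= (1 - chip_prob U V r) * wt U (V - m) r.
Proof.
move=> hU' hV' w0; have hU : 63 <= U by lra.
have hV : 63 <= V by lra.
have [U0 V0 s0] := pos63 hU hV; have [Un0 Vn0 sn0] := neq63 hU hV.
have m0 : 0 < m := step_gt0 hU hV.
have m1 : m <= 1 := step_le1 hU hV.
have p0 := chip_prob_ge0 r hU hV.
have hr := wt_gt0_le hU hV w0.
have p1 := chip_prob_lt1 hU hV hr.
have p2 := chip_prob_sq hU hV hr.
rewrite -/m in p2.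
set p := chip_prob U V r in p0 p1 p2 *; set e := (U / (U + V)) ^+ r.
have e0 : 0 < e by rewrite exprn_gt0 // divr_gt0.
have s'0 : 0 < U + V - m by lra.
have s'n0 : U + V - m != 0 by rewrite lt0r_neq0.
pose c := (U + V) / (U + V - m).
have scale w : (w / (U + (V - m))) ^+ r = c ^+ r * (w / (U + V)) ^+ r.
  rewrite -exprMn; congr (_ ^+ _); rewrite /c addrA; field.
  by rewrite s'n0 sn0.
have -> : wt U (V - m) r = c ^+ r * (wt U V r + ((V - m)^-1 - V^-1) * e).
  by rewrite /wt !scale /e; ring.
have D : m / V ^+ 2 <= (V - m)^-1 - V^-1.
  rewrite -subr_ge0.
  have -> : (V - m)^-1 - V^-1 - m / V ^+ 2 = m ^+ 2 / (V ^+ 2 * (V - m)).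
    by field; rewrite Vn0 /= lt0r_neq0 //; lra.
  by apply: divr_ge0; [exact: sqr_ge0|apply: mulr_ge0; [exact: sqr_ge0|lra]].
have phi : 1 - p ^+ 2 <= (1 - p) * c ^+ r.
  have cE : c = 1 + m / (U + V - m) by rewrite /c; field.
  have cb : 1 + r%:R * (m / (U + V - m)) <= c ^+ r.
    by rewrite cE; apply: bernoulli_ge; have := divr_gt0 m0 s'0; lra.
  have pb : p <= r%:R * (m / (U + V - m)).
    rewrite /p /chip_prob -/m -mulrA ler_wpM2l ?ler0n // ler_pM2l //.
    by rewrite lef_pV2 ?posrE //; lra.
  by nra.
have we : wt U V r <= 2 * e := wt_le r hU hV.
have V2 : 0 < (V ^+ 2)^-1 by rewrite invr_gt0 exprn_gt0.
have mV : 0 < m / V ^+ 2 by rewrite mulr_gt0.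
have mV1 : m / V ^+ 2 <= 1.
  by rewrite ler_pdivrMr ?exprn_gt0 //; nra.
have -> : m / (2 * V ^+ 2) = (m / V ^+ 2) / 2 by field.
set X := m / V ^+ 2 in p2 D mV mV1 *; set Y := _ - V^-1 in D *.
rewrite [leRHS]mulrA; apply: (@le_trans _ _ ((1 - p ^+ 2) * (wt U V r + X * e))).
  have q0 := sqr_ge0 p.
  have : 0 <= (X - 8 * p ^+ 2) * e by rewrite mulr_ge0 ?subr_ge0 // ltW.
  have : 0 <= p ^+ 2 * (2 * e - wt U V r) by rewrite mulr_ge0 // subr_ge0.
  have pe : 0 <= p ^+ 2 * e by rewrite mulr_ge0 // ltW.
  have : 0 <= p ^+ 2 * e * (1 - X) by rewrite mulr_ge0 // subr_ge0.
  have : 0 < X * e by rewrite mulr_gt0.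
  by lra.
apply: ler_pM => //; [by nra|by nra|].
by rewrite lerD2l ler_pM2r.
Qed.

(** Tangents at [x] for the exponents r and r - 1: the first order terms cancel and a second order
    loss remains. *)
Lemma expr_sub_add_ge (x d : R) r : 0 <= d -> d <= x ->
  x ^+ r - (r%:R * d) ^+ 2 * x ^+ r.-2 <=
    (x - d) ^+ r + r%:R * d * (x - d) ^+ r.-1.
Proof.
move=> d0 dx; case: r => [|[|r]].
- by rewrite !expr0 !mul0r expr0n /=; lra.
- by rewrite !expr1 !expr0; nra.
have x0 : 0 <= x by lra.
have y0 : 0 <= x - d by lra.
have xr : 0 <= x ^+ r by rewrite exprn_ge0.
have b1 := @exprD_ge_tangent R x (- d) r.+2 x0 y0.
have b2 := @exprD_ge_tangent R x (- d) r.+1 x0 y0.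
rewrite /= in b1 b2 *.
have rd0 : 0 <= r.+2%:R * d by rewrite mulr_ge0 ?ler0n.
have b3 := ler_wpM2l rd0 b2.
apply: le_trans (lerD b1 b3); rewrite -subr_ge0.
have -> : x ^+ r.+2 + r.+2%:R * - d * x ^+ r.+1
   + r.+2%:R * d * (x ^+ r.+1 + r.+1%:R * - d * x ^+ r)
   - (x ^+ r.+2 - (r.+2%:R * d) ^+ 2 * x ^+ r) = r.+2%:R * d ^+ 2 * x ^+ r.
  by rewrite -[r.+2%:R]natr1; ring.
by apply: mulr_ge0 => //; apply: mulr_ge0; [exact: ler0n|exact: sqr_ge0].
Qed.

(** Painter colors on the right: a proportion p of the left vertices drops to label r - 1, and [U]
    drops by [m]. By convexity the two subtracted powers do not increase. The leading power has a
    second order loss, paid by the rise of [U^-1] in its coefficient. *)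
Lemma wt_push U V r (m := step U V) (p := chip_prob U V r) :
  64 <= U -> 64 <= V -> 0 < wt U V r ->
  wt U V r <= p * wt (U - m) V r.-1 + (1 - p) * wt (U - m) V r.
Proof.
move=> hU' hV' w0; have hU : 63 <= U by lra.
have hV : 63 <= V by lra.
have [U0 V0 s0] := pos63 hU hV; have [Un0 Vn0 sn0] := neq63 hU hV.
have m0 : 0 < m := step_gt0 hU hV.
have m1 : m <= 1 := step_le1 hU hV.
have p0 : 0 <= p := chip_prob_ge0 r hU hV.
have hr := wt_gt0_le hU hV w0.
have p1 : p < 1 := chip_prob_lt1 hU hV hr.
have s'0 : 0 < U - m + V by lra.
have s'n0 : U - m + V != 0 by rewrite lt0r_neq0.
have r8 := wt_gt0_ge hU hV w0.
have r2 : (2 < r)%N by rewrite -(ltr_nat R); lra.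
have d2 w : (w - m) / (U - m + V) = w / (U + V) -
    m / (U + V) * ((U + V - w) / (U - m + V)).
  by field; rewrite sn0 s'n0.
have pE : p = r%:R * (m / (U + V)) by rewrite /p /chip_prob mulrA.
have mE : m * (U * V) ^+ 2 = eps * (U + V) ^+ 2 := step_mulUV hU hV.
clearbody p m.
(* The average after the round of the power belonging to [w]. By [NE] it is the tangent at the new
   base, evaluated at the old base w / (U + V). *)
pose N w := p * ((w - m) / (U - m + V)) ^+ r.-1 +
            (1 - p) * ((w - m) / (U - m + V)) ^+ r.
have NE w : N w = ((w - m) / (U - m + V)) ^+ r + r%:R * (m / (U + V) *
    ((U + V - w) / (U - m + V))) * ((w - m) / (U - m + V)) ^+ r.-1.
  have -> : (U + V - w) / (U - m + V) = 1 - (w - m) / (U - m + V) by field.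
  have rE : ((w - m) / (U - m + V)) ^+ r =
     (w - m) / (U - m + V) * ((w - m) / (U - m + V)) ^+ r.-1.
    by rewrite -exprS prednK //; apply: leq_trans r2.
  by rewrite /N rE pE; ring.
have up w : m <= w -> N w <= (w / (U + V)) ^+ r.
  move=> mw; rewrite NE; set d := m / _ * _.
  have -> : w / (U + V) = (w - m) / (U - m + V) + d by rewrite d2 subrK.
  apply: exprD_ge_tangent; first by rewrite divr_ge0 //; lra.
  by rewrite d2 subrK divr_ge0 //; lra.
have up1 : N (U - 4) <= ((U - 4) / (U + V)) ^+ r by apply: up; lra.
have up2 : N (U + 4) <= ((U + 4) / (U + V)) ^+ r by apply: up; lra.
pose x := U / (U + V); pose d := m / (U + V) * (V / (U - m + V)).
have x0 : 0 < x by rewrite divr_gt0.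
have d0 : 0 <= d by rewrite mulr_ge0 ?divr_ge0 //; lra.
have dU : (U - m) / (U - m + V) = x - d.
  by rewrite d2 [U + V - U]addrAC subrr add0r.
have dx : d <= x by rewrite -subr_ge0 -dU divr_ge0 //; lra.
have lo : x ^+ r - (r%:R * d) ^+ 2 * x ^+ r.-2 <= N U.
  by rewrite NE dU [U + V - U]addrAC subrr add0r; exact: expr_sub_add_ge.
(* The factor 8 in [eps] is used up here: 2 bounds the coefficient [th], and 4 is the square of the
   2 in U + V <= 2 (U + V - m). *)
have rd : 2 * (r%:R * d) ^+ 2 <= x ^+ 2 * (m / U ^+ 2).
  have rdE : r%:R * d <= 2 * (162 * m * V / (U + V) * x).
    rewrite /d /x.
    have k0 : 0 <= m / (U + V) * (V / (U - m + V)).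
      by rewrite mulr_ge0 ?divr_ge0 //; lra.
    apply: (le_trans (ler_wpM2r k0 hr)).
    have -> : 162 * U * (m / (U + V) * (V / (U - m + V))) =
      162 * m * V / (U + V) * U * (U - m + V)^-1 by ring.
    rewrite [X in _ <= X](_ : _ = 162 * m * V / (U + V) * U * (2 / (U + V))).
      rewrite ler_wpM2l //.
        by apply: mulr_ge0 (ltW U0); apply: divr_ge0 (ltW s0); rewrite !mulr_ge0 // ltW.
      by rewrite -[X in X <= _]mul1r ler_pdivrMr // mulrAC ler_pdivlMr //; lra.
    by field.
  have ge0 : 0 <= r%:R * d by rewrite mulr_ge0 ?ler0n.
  apply: (@le_trans _ _ (2 * (2 * (162 * m * V / (U + V) * x)) ^+ 2)).
    rewrite ler_pM2l ?ltr0n // ler_sqr ?nnegrE //.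
    exact: le_trans ge0 rdE.
  have -> : x ^+ 2 * (m / U ^+ 2) = m * x ^+ 2 * (8 * 162 ^+ 2 * eps) / U ^+ 2.
    by rewrite epsE; ring.
  have epsU : eps = m * (U * V) ^+ 2 / (U + V) ^+ 2.
    by rewrite mE mulfK // expf_neq0.
  rewrite epsU le_eqVlt; apply/orP; left; apply/eqP; field.
  by rewrite sn0 Un0.
have xr2 : 0 < x ^+ r.-2 by rewrite exprn_gt0.
have xrE : x ^+ r = x ^+ 2 * x ^+ r.-2.
  by rewrite -exprD addnC addn2 -subn2 -addn2 subnK // ltnW.
have D : m / U ^+ 2 <= (U - m)^-1 - U^-1.
  rewrite -subr_ge0.
  have -> : (U - m)^-1 - U^-1 - m / U ^+ 2 = m ^+ 2 / (U ^+ 2 * (U - m)).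
    by field; rewrite Un0 /= lt0r_neq0 //; lra.
  by apply: divr_ge0; [exact: sqr_ge0|apply: mulr_ge0; [exact: sqr_ge0|lra]].
have hU1 : 63 <= U - m by lra.
have /andP[t1 t2] := coef_bounds hU1 hV.
set th := 1 + (U - m)^-1 + V^-1 in t1 t2.
have -> : p * wt (U - m) V r.-1 + (1 - p) * wt (U - m) V r =
   th * N U - 4 * N (U - 4) - 324^-1 * N (U + 4).
  by rewrite /wt /N /th ![U - m - 4]addrAC ![U - m + 4]addrAC; ring.
have main : (1 + U^-1 + V^-1) * x ^+ r <= th * N U.
  apply: (le_trans _ (ler_wpM2l (le_trans ler01 t1) lo)).
  rewrite -subr_ge0.
  have -> : th * (x ^+ r - (r%:R * d) ^+ 2 * x ^+ r.-2)
     - (1 + U^-1 + V^-1) * x ^+ r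
    = (((U - m)^-1 - U^-1) * x ^+ 2 - th * (r%:R * d) ^+ 2) * x ^+ r.-2.
    by rewrite xrE /th; ring.
  apply: mulr_ge0 (ltW xr2); rewrite subr_ge0.
  apply: (@le_trans _ _ (2 * (r%:R * d) ^+ 2)).
    by rewrite ler_wpM2r ?sqr_ge0.
  by apply: (le_trans rd); rewrite mulrC ler_wpM2r ?sqr_ge0.
by rewrite /wt -/x; lra.
Qed.

(** The right-hand side is the rounding allowance of a round, at least of order K / V^4. Since r >=
    U / 8, the power (1 + V / (2 U))^r is at least of order V^4, so one vertex fits into the
    allowance. *)
Lemma wt_cap K U V r (m := step U V) : 64 <= U -> 64 <= V -> 0 < wt U V r ->
  8 * 128 ^+ 4 <= K * eps ->
  wt U (V - m) r <= K / 2 * (m / (2 * V ^+ 2)).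
Proof.
move=> hU' hV' w0 hK; have hU : 63 <= U by lra.
have hV : 63 <= V by lra.
have [U0 V0 s0] := pos63 hU hV; have [Un0 Vn0 sn0] := neq63 hU hV.
have m0 : 0 < m := step_gt0 hU hV.
have m1 : m <= 1 := step_le1 hU hV.
have mV : eps <= m * V ^+ 2 := step_ge hU hV.
have r8 := wt_gt0_ge hU hV w0.
have hV1 : 63 <= V - m by lra.
apply: (le_trans (wt_le r hU hV1)).
have s'0 : 0 < U + (V - m) by lra.
(* Bernoulli on each of four [q]-th powers produces the fourth power of [V]. *)
pose q := (r %/ 4)%N.
have q1 : U <= 64 * q%:R.
  apply: (le_trans r8).
  have : (r <= 8 * q)%N.
    have r3 : (3 < r)%N by rewrite -(ltr_nat R); lra.
    have q0 : (0 < q)%N by rewrite divn_gt0.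
    have := ltn_ceil r (isT : 0 < 4)%N; rewrite -/q => h.
    apply: leq_trans (ltnW h) _; rewrite mulSn mulnC.
    by rewrite -[8%N]/(4 + 4)%N mulnDl leq_add2r -[leqLHS]muln1 leq_mul2l.
  by rewrite -(ler_nat R) natrM; lra.
pose t := V / (2 * U).
have t0 : 0 < t by rewrite divr_gt0 // mulr_gt0.
have tq : V / 128 <= t * q%:R.
  rewrite /t mulrAC ler_pdivlMr; last by lra.
  by nra.
have V4 : 0 < (V / 128) ^+ 4 by rewrite exprn_gt0 //; lra.
have b : (V / 128) ^+ 4 <= (1 + t) ^+ r.
  apply: (@le_trans _ _ (((1 + t) ^+ q) ^+ 4)).
    apply: lerXn2r; rewrite ?nnegrE; first by lra.
      by rewrite exprn_ge0 //; lra.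
    apply: (le_trans tq); have := @bernoulli_ge R t q; rewrite mulrC.
    by have : -1 <= t by [lra]; move=> h /(_ h); lra.
  rewrite -exprM; apply: ler_weXn2l; first by lra.
  exact: leq_divM.
have c : (U / (U + (V - m))) ^+ r <= ((V / 128) ^+ 4)^-1.
  apply: (@le_trans _ _ (((1 + t) ^+ r)^-1)); last first.
    by rewrite lef_pV2 ?posrE // exprn_gt0 //; lra.
  rewrite -exprVn; apply: lerXn2r; rewrite ?nnegrE.
  - by rewrite divr_ge0 //; lra.
  - by rewrite invr_ge0; lra.
  rewrite ler_pdivrMr // mulrC ler_pdivlMr; last by lra.
  have -> : U * (1 + t) = U + V / 2 by rewrite /t; field.
  by lra.
apply: (le_trans (ler_wpM2l (ler0n R 2) c)).
have -> : K / 2 * (m / (2 * V ^+ 2)) = K * (m * V ^+ 2) / (4 * V ^+ 4).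
  by field.
have -> : 2 * ((V / 128) ^+ 4)^-1 = 8 * 128 ^+ 4 / (4 * V ^+ 4).
  by field.
rewrite ler_pM2r; last by rewrite invr_gt0 mulr_gt0 ?exprn_gt0.
have e0 : 0 < eps by exact: eps_gt0.
have K0 : 0 <= K by rewrite -(pmulr_lge0 _ e0); apply: le_trans hK; lra.
exact: (le_trans hK (ler_wpM2l K0 mV)).
Qed.

End Weight.

(** * One round *)

(* The greedy solution of the knapsack problem has one fractional item. *)
Lemma knapsack_rounding (R : realFieldType) (I : finType) (A : {set I})
    (g q p : I -> R) (Q : R) :
  (forall i, i \in A -> [/\ 0 <= g i, 0 < q i <= Q & 0 <= p i <= 1]) ->
  0 <= Q ->
  exists S : {set I}, [/\ S \subset A,
    \sum_(i in A) p i * g i <= \sum_(i in S) g i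
    & \sum_(i in S) q i <= \sum_(i in A) p i * q i + Q].
Proof.
move=> + Q0; have [n] := ubnP #|A|; elim: n A p => // n IH A p /ltnSE cA H.
have [->|/set0Pn[i0 Ai0]] := eqVneq A finset.set0.
  by exists finset.set0; rewrite finset.sub0set !big_set0 add0r.
case: (arg_maxP (fun i => g i / q i) Ai0) => c + cmax; rewrite -/(c \in A) => Ac.
have [gc /andP[qc qcQ] /andP[pc0 pc1]] := H c Ac.
have ratio i : i \in A -> q c * g i <= g c * q i.
  move=> Ai; have [gi /andP[qi _] _] := H i Ai.
  have := cmax i Ai; rewrite /= ler_pdivrMr // mulrAC ler_pdivlMr //.
  by rewrite [g i * _]mulrC.
have splitA (F : I -> R) : \sum_(i in A) F i = F c + \sum_(i in A :\ c) F i.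
  by rewrite (big_setD1 c).
have inA i : i \in A :\ c -> i \in A by rewrite in_setD1 => /andP[].
have [le_gc|lt_gc] := lerP (\sum_(i in A) p i * g i) (g c).
  exists [set c]; rewrite finset.sub1set !big_set1; split=> //.
  apply: le_trans qcQ _; rewrite lerDr sumr_ge0 // => i Ai.
  have [_ /andP[qi _] /andP[pi _]] := H i Ai.
  by rewrite mulr_ge0 // ltW.
pose G := \sum_(i in A :\ c) p i * g i; pose P := \sum_(i in A :\ c) p i * q i.
have hG : (1 - p c) * g c < G by move: lt_gc; rewrite splitA -/G; lra.
have G0 : 0 < G by apply: le_lt_trans hG; rewrite mulr_ge0 // subr_ge0.
(* The item [c] of best ratio is taken whole, and the other proportions shrink by 1 - t so that the
   total of p g is unchanged. By the choice of [c], the cost saved covers the cost added. *)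
pose t := (1 - p c) * g c / G.
have t0 : 0 <= t by rewrite divr_ge0 ?mulr_ge0 ?subr_ge0 // ltW.
have t1 : t <= 1 by rewrite ler_pdivrMr // mul1r ltW.
have GP : q c * G <= g c * P.
  rewrite /G /P !mulr_sumr; apply: ler_sum => i /inA Ai.
  have [_ _ /andP[pi0 _]] := H i Ai.
  by rewrite mulrCA [g c * _]mulrCA ler_wpM2l // ratio.
case: (IH (A :\ c) (fun i => (1 - t) * p i)).
- by move: cA; rewrite (cardsD1 c) Ac.
- move=> i /inA Ai; have [gi qi /andP[pi0 pi1]] := H i Ai; split=> //.
  by rewrite mulr_ge0 ?subr_ge0 //= mulr_ile1 // ?subr_ge0 // lerBlDr lerDl.
move=> S [sS hg hq]; exists (c |: S).
have cS : c \notin S by apply/negP => /(fintype.subsetP sS); rewrite !inE eqxx.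
rewrite !big_setU1 //= !splitA -/G -/P; split.
- by rewrite finset.subUset finset.sub1set Ac (fintype.subset_trans sS) ?finset.subD1set.
- have : (1 - t) * G <= \sum_(i in S) g i.
    apply: le_trans hg; rewrite mulr_sumr le_eqVlt; apply/orP; left; apply/eqP.
    by apply: eq_bigr => i _; rewrite mulrA.
  have -> : (1 - t) * G = G - (1 - p c) * g c.
    by rewrite /t; field; rewrite lt0r_neq0.
  by lra.
- have : \sum_(i in S) q i <= (1 - t) * P + Q.
    apply: le_trans hq _; rewrite lerD2r mulr_sumr le_eqVlt; apply/orP; left.
    by apply/eqP; apply: eq_bigr => i _; rewrite mulrA.
  have : (1 - p c) * q c <= t * P.
    rewrite /t mulrAC ler_pdivlMr // -[leLHS]mulrA -[leRHS]mulrA.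
    by rewrite ler_wpM2l ?subr_ge0.
  by lra.
Qed.

Lemma ler_sum_pos_part (R : realFieldType) (T : finType) (X : {set T}) (F : T -> R) :
  \sum_(x in X) F x <= \sum_(x in [set x in X | 0 < F x]) F x.
Proof.
rewrite (bigID (fun x => 0 < F x)) /= -[leRHS]addr0; apply: lerD.
  rewrite le_eqVlt; apply/orP; left; apply/eqP.
  by apply: eq_bigl => x; rewrite inE.
by apply: sumr_le0 => x /andP[_]; rewrite -leNgt.
Qed.

(** One side of a round: [S] is presented, [A1] with labels [a1] is left if Painter colors the
    opposite side, and [A2] if Painter colors this side. In the knapsack, an item's profit is its
    gain from being pushed and its cost the value lost if it is colored. The overshoot [Q] is
    covered by the surplus of [wt_kill], because the sum of the [e v] is at least K / 2. *)
Lemma push_or_kill (R : realFieldType) (I : finType) (A : {set I}) (a : I -> nat)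
    (K U V : R) (m := step U V) :
  64 <= U -> 64 <= V -> 0 <= K -> 8 * 128 ^+ 4 <= K * eps R ->
  K <= \sum_(v in A) wt U V (a v) ->
  exists (S A1 A2 : {set I}) (a1 : I -> nat),
  [/\ S \subset A,
      A1 \subset A /\
        {in A1, forall v, ((if v \in S then (a v).-1 else a v) <= a1 v)%N},
      A2 \subset A :\: S,
      K <= \sum_(v in A1) wt (U - m) V (a1 v)
    & K <= \sum_(v in A2) wt U (V - m) (a v)].
Proof.
move=> hU' hV' K0 hK hA; have hU : 63 <= U by lra.
have hV : 63 <= V by lra.
have [U0 V0 s0] := pos63 hU hV.
have m0 : 0 < m := step_gt0 hU hV.
pose B := [set v in A | 0 < wt U V (a v)].
have sBA : B \subset A by apply/fintype.subsetP => v; rewrite inE => /andP[].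
have wB v : v \in B -> 0 < wt U V (a v) by rewrite inE => /andP[].
have hB : K <= \sum_(v in B) wt U V (a v).
  exact: le_trans hA (ler_sum_pos_part _ _).
pose f1 := wt (U - m) V; pose f2 := wt U (V - m); pose p := chip_prob U V.
(* A lower label can be worth less. As labels are only upper bounds, the old one may be kept, which
   makes the gain nonnegative. *)
pose g v := Num.max (f1 (a v).-1) (f1 (a v)) - f1 (a v).
pose e v := (U / (U + V)) ^+ a v.
pose D := m / (2 * V ^+ 2).
have D0 : 0 < D by rewrite divr_gt0 // mulr_gt0 ?exprn_gt0.
pose Q := K / 2 * D.
have p01 v : v \in B -> 0 <= p (a v) < 1.
  move=> /wB w; rewrite chip_prob_ge0 //= chip_prob_lt1 //; exact: wt_gt0_le w.
have e0 v : 0 < e v by rewrite exprn_gt0 // divr_gt0.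
have kill v : v \in B -> wt U V (a v) + e v * D <= (1 - p (a v)) * f2 (a v).
  by move=> /wB; exact: wt_kill.
have f2_gt0 v : v \in B -> 0 < f2 (a v).
  move=> vB; have /andP[_ p1] := p01 v vB.
  rewrite -(pmulr_rgt0 _ (_ : 0 < 1 - p (a v))) ?subr_gt0 //.
  by apply: lt_le_trans (kill v vB); rewrite addr_gt0 ?wB // mulr_gt0.
have [S [sSB hg hq]] : exists S : {set I}, [/\ S \subset B,
    \sum_(v in B) p (a v) * g v <= \sum_(v in S) g v
    & \sum_(v in S) f2 (a v) <= \sum_(v in B) p (a v) * f2 (a v) + Q].
  apply: (@knapsack_rounding R I B g (f2 \o a) (p \o a)) => [v vB|]; last first.
    by apply: mulr_ge0 (ltW D0); lra.
  have /andP[pp0 pp1] := p01 v vB; split.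
  - by rewrite subr_ge0 le_max lexx orbT.
  - by rewrite /= f2_gt0 //= wt_cap // wB.
  - by rewrite /= pp0 ltW.
exists S, B, (B :\: S), (fun v => if (v \in S) && (f1 (a v) <= f1 (a v).-1)
  then (a v).-1 else a v).
split.
- exact: fintype.subset_trans sSB sBA.
- split=> // v vB; case: (v \in S) => //=; case: ifP => // _; exact: leq_pred.
- exact: finset.setSD.
- have -> : \sum_(v in B) wt (U - m) V (if (v \in S) && (f1 (a v) <= f1 (a v).-1)
      then (a v).-1 else a v) = \sum_(v in B) f1 (a v) + \sum_(v in S) g v.
    have -> : \sum_(v in S) g v = \sum_(v in B) (if v \in S then g v else 0).
      rewrite -big_mkcondr /=; apply: eq_bigl => v.
      by case: (boolP (v \in S)) => [/(fintype.subsetP sSB) ->|]; rewrite ?andbF.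
    rewrite -big_split /=; apply: eq_bigr => v vB.
    case: (v \in S) => /=; last by rewrite addr0.
    by rewrite /g addrC subrK; case: lerP.
  apply: le_trans hB _; apply: (le_trans _ (lerD (lexx _) hg)).
  rewrite -big_split /=; apply: ler_sum => v vB.
  apply: le_trans (wt_push hU' hV' (wB v vB)) _; rewrite -/m -/f1 -/p.
  have /andP[pp0 pp1] := p01 v vB.
  have : p (a v) * f1 (a v).-1 <= p (a v) * Num.max (f1 (a v).-1) (f1 (a v)).
    by rewrite ler_wpM2l // le_max lexx.
  by rewrite /g; lra.
have -> : \sum_(v in B :\: S) wt U (V - m) (a v) =
    \sum_(v in B) f2 (a v) - \sum_(v in S) f2 (a v).
  by apply/eqP; rewrite eq_sym subr_eq (big_setID S) /= (finset.setIidPr sSB) addrC.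
have h1 : \sum_(v in B) (wt U V (a v) + e v * D) <=
    \sum_(v in B) f2 (a v) - \sum_(v in B) p (a v) * f2 (a v).
  rewrite -sumrB; apply: ler_sum => v vB; apply: le_trans (kill v vB) _.
  by rewrite mulrBl mul1r.
have h2 : Q <= \sum_(v in B) e v * D.
  rewrite -mulr_suml ler_pM2r // ler_pdivrMr // mulr_suml.
  apply: le_trans hB _; apply: ler_sum => v _; rewrite mulrC; exact: wt_le.
by rewrite big_split /= in h1; lra.
Qed.

(** * Lister's strategy *)

Definition push (I : finType) (S : {set I}) (a : I -> nat) (v : I) : nat :=
  if v \in S then (a v).-1 else a v.

(* [A], [B] are the vertices still in use on each side; [a], [b] bound from above
   the number of permissible colors they lack.  In a round, Painter colors on one
   side only, so the vertices presented on the other side survive. *)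
Inductive lister_forces (I J : finType) :
    {set I} -> (I -> nat) -> {set J} -> (J -> nat) -> Prop :=
| ForceLeft (A : {set I}) a (B : {set J}) b v : v \in A -> a v = 0%N ->
    lister_forces A a B b
| ForceRight (A : {set I}) a (B : {set J}) b w : w \in B -> b w = 0%N ->
    lister_forces A a B b
| ForceRound (A : {set I}) a (B : {set J}) b (S : {set I}) (T : {set J}) :
    S \subset A -> T \subset B ->
    lister_forces A (push S a) (B :\: T) b ->
    lister_forces (A :\: S) a B (push T b) -> lister_forces A a B b
| ForceWeaken (A : {set I}) a (B : {set J}) b
    (A' : {set I}) a' (B' : {set J}) b' : A' \subset A -> B' \subset B ->
    {in A', forall v, (a v <= a' v)%N} -> {in B', forall w, (b w <= b' w)%N} ->
    lister_forces A' a' B' b' -> lister_forces A a B b.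

Lemma lister_forces_sym (I J : finType) (A : {set I}) a (B : {set J}) b :
  lister_forces A a B b -> lister_forces B b A a.
Proof.
elim=> {A a B b} [A a B b v vA av|A a B b w wB bw
  |A a B b S T sS sT _ h1 _ h2|A a B b A' a' B' b' sA sB ha hb _ h].
- exact: ForceRight av.
- exact: ForceLeft bw.
- exact: ForceRound h2 h1.
- exact: ForceWeaken h.
Qed.

Lemma subset_of_card (I : finType) (A : {set I}) n :
  (n <= #|A|)%N -> exists2 S : {set I}, S \subset A & #|S| = n.
Proof.
case/card_geqP => s [us sn sA]; exists [set x in s].
  by apply/fintype.subsetP => x; rewrite inE => /sA.
by rewrite cardsE (card_uniqP us).
Qed.

(* Lister threatens with one right vertex w, each time against c^(n-1) fresh left
   vertices of label n: either w reaches label 0, or Painter colors w and leaves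
   c^(n-1) left vertices of label n-1. *)
Lemma endgame (I J : finType) n c (A : {set I}) a (B : {set J}) b :
  {in A, forall v, (a v <= n)%N} -> {in B, forall w, (b w <= c)%N} ->
  (c ^ n <= #|A|)%N -> (n <= #|B|)%N -> lister_forces A a B b.
Proof.
elim: n A a B b => [|n IH] A a B b hA hB cA cB.
  have /card_gt0P[v vA] : (0 < #|A|)%N by rewrite (leq_trans _ cA).
  by apply: (ForceLeft _ _ vA); apply/eqP; rewrite -leqn0 hA.
have /card_gt0P[w wB] : (0 < #|B|)%N by apply: leq_trans cB.
have {cA} : (c * c ^ n <= #|A|)%N by rewrite -expnS.
(* Inner induction on a bound [j] for the label of [w]; the left side still holds enough vertices
   for [j] threats. *)
move: {-3}c (hB w wB) => j; elim: j A b hA hB => [|j IHj] A b hA hB bw cA.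
  by apply: (ForceRight _ _ wB); apply/eqP; rewrite -leqn0.
have [S sSA cS] : exists2 S : {set I}, S \subset A & #|S| = (c ^ n)%N.
  by apply: subset_of_card; apply: leq_trans cA; rewrite mulSn leq_addr.
apply: (@ForceRound _ _ _ _ _ _ S [set w]) => //; first by rewrite finset.sub1set.
  apply: (@ForceWeaken _ _ _ _ _ _ S (push S a) (B :\ w) b) => //.
  apply: IH => [v vS|x|//|].
  - by rewrite /push vS; have := hA v (fintype.subsetP sSA v vS); case: (a v).
  - by rewrite in_setD1 => /andP[_ /hB].
  - by rewrite cS.
  - by move: cB; rewrite (cardsD1 w) wB.
apply: IHj => [v|x xB||].
- by rewrite inE => /andP[_ /hA].
- rewrite /push; case: ifP => _; last exact: hB.
  by apply: leq_trans (leq_pred _) _; exact: hB.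
- by rewrite /push inE eqxx; case: (b w) bw.
- rewrite finset.cardsD (finset.setIidPr sSA) cS.
  by move: cA; rewrite mulSn; lia.
Qed.

(** * Enough value on both sides forces a win for Lister *)

Section Potential.
Variable R : realType.
Implicit Types (U V K L : R).

(** Pigeonhole over the boundedly many left labels: with fewer than c^r vertices of every label r,
    the left value would be at most the sum of 2 (c U / (U + V))^r, and c U / (U + V) <= 162 U <=
    [H]. On the right each vertex is worth at most 2, so at least [m] of them remain, as [endgame]
    requires. *)
Lemma bounded_remainder_forces : exists K0 : R, 0 <= K0 /\
  forall (I J : finType) (A : {set I}) a (B : {set J}) b U V,
  63 <= U -> U <= 64 -> 63 <= V ->
  K0 <= \sum_(v in A) wt U V (a v) -> K0 <= \sum_(w in B) wt V U (b w) ->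
  lister_forces A a B b.
Proof.
pose H : R := 162 * 64; pose m := (Num.truncn H).+1.
have Hm : H < m%:R by rewrite truncnS_gt.
pose G : R := \sum_(r < m) H ^+ r.
have G0 : 0 <= G by apply: sumr_ge0 => r _; rewrite exprn_ge0 // mulr_ge0.
exists (2 * m%:R + 2 * G + 1); split.
  by have : 0 <= m%:R :> R := ler0n _ _; lra.
move=> I J A a B b U V hU hU' hV hA hB.
have [U0 V0 s0] := pos63 hU hV.
have s0' : 0 < V + U by lra.
pose A' := [set v in A | 0 < wt U V (a v)].
pose B' := [set w in B | 0 < wt V U (b w)].
pose c := Num.truncn (162 * V).
have bc w : w \in B' -> (b w <= c)%N.
  rewrite inE => /andP[_ /(wt_gt0_le hV hU) h].
  by rewrite truncn_ge_nat // mulr_ge0 // ltW.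
have am v : v \in A' -> (a v < m)%N.
  rewrite inE => /andP[_ /(wt_gt0_le hU hV) h].
  rewrite -(ltr_nat R); apply: le_lt_trans Hm; apply: (le_trans h).
  by rewrite ler_pM2l.
have cardB : (m <= #|B'|)%N.
  rewrite -(ler_nat R).
  have : \sum_(w in B') wt V U (b w) <= \sum_(w in B') 2.
    apply: ler_sum => w _; apply: (le_trans (wt_le _ hV hU)).
    rewrite -[leRHS]mulr1 ler_pM2l // exprn_ile1 // ?divr_ge0 ?(ltW V0) ?(ltW s0') //.
    by rewrite ler_pdivrMr // mul1r; lra.
  rewrite sumr_const -[2 *+ _]mulr_natr.
  by move: (le_trans hB (ler_sum_pos_part _ _)) => /le_trans /[apply]; lra.
pose Ar (r : 'I_m) := [set v in A' | a v == r].
have [r hr] : exists r : 'I_m, (c ^ r <= #|Ar r|)%N.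
  apply/existsP; apply: contraT; rewrite negb_exists => /forallP h.
  have : \sum_(v in A') wt U V (a v) <= 2 * G; last first.
    move: (le_trans hA (ler_sum_pos_part _ _)) => /le_trans /[apply].
    by have : 0 <= m%:R :> R := ler0n _ _; lra.
  rewrite (partition_big (fun v => inord (a v) : 'I_m) xpredT) //=.
  rewrite mulr_sumr; apply: ler_sum => r _.
  have -> : \sum_(v in A' | inord (a v) == r) wt U V (a v) =
            \sum_(v in Ar r) wt U V r.
    apply: eq_big => [v|v /andP[vA /eqP <-]]; last by rewrite inordK ?am.
    rewrite [RHS]inE; case: (boolP (v \in A')) => //= vA.
    by rewrite -val_eqE /= inordK ?am.
  rewrite sumr_const -[wt _ _ _ *+ _]mulr_natr.
  have x0 : 0 <= U / (U + V) by rewrite divr_ge0 ?ltW.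
  have c0 : 0 <= c%:R * (U / (U + V)) by rewrite mulr_ge0.
  apply: (@le_trans _ _ (2 * (U / (U + V)) ^+ r * c%:R ^+ r)).
    apply: (@le_trans _ _ (2 * (U / (U + V)) ^+ r * #|Ar r|%:R)).
      by rewrite ler_wpM2r // wt_le.
    rewrite ler_wpM2l ?mulr_ge0 ?exprn_ge0 // -natrX ler_nat ltnW // ltnNge.
    exact: h.
  rewrite -mulrA ler_pM2l // -exprMn mulrC; apply: lerXn2r; rewrite ?nnegrE //.
    by rewrite mulr_ge0.
  apply: (@le_trans _ _ (162 * V * (U / (U + V)))).
    by rewrite ler_wpM2r // truncn_le mulr_ge0 // ltW.
  by rewrite mulrA ler_pdivrMr // /H; nra.
apply: (@ForceWeaken _ _ A a B b (Ar r) a B' b) => //.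
- by apply/fintype.subsetP => v; rewrite !inE => /andP[/andP[]].
- by apply/fintype.subsetP => v; rewrite !inE => /andP[].
- apply: (@endgame _ _ r c) => //.
  + by move=> v; rewrite inE => /andP[_ /eqP ->].
  + by apply: leq_trans cardB; apply: ltnW.
Qed.

(** Each round lowers U + V by at least a fixed [d], since [L] bounds the steps from below; so [U]
    or [V] reaches 64 after finitely many rounds. *)
Lemma potential_forces : exists2 K : R, 0 <= K &
  forall (I J : finType) L U V (A : {set I}) a (B : {set J}) b,
  63 <= U <= L -> 63 <= V <= L ->
  K <= \sum_(v in A) wt U V (a v) -> K <= \sum_(w in B) wt V U (b w) ->
  lister_forces A a B b.
Proof.
have [K0 [K00 fin]] := bounded_remainder_forces.
have e0 : 0 < eps R := eps_gt0 R.
(* [K0] suffices for the final phase; the other summand is what [wt_cap] demands. *)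
pose K := K0 + 8 * 128 ^+ 4 / eps R.
have hK : 8 * 128 ^+ 4 <= K * eps R.
  by rewrite /K [leRHS]mulrDl divfK ?lt0r_neq0 // lerDr; apply: mulr_ge0 K00 (ltW e0).
have K0K : K0 <= K by rewrite lerDl divr_ge0 ?mulr_ge0 ?exprn_ge0 // ltW.
have Kge0 : 0 <= K := le_trans K00 K0K.
exists K => // I J L U V A a B b hU hV.
have L0 : 0 < L by lra.
pose d := eps R / L ^+ 2.
have d0 : 0 < d by rewrite divr_gt0 ?exprn_gt0.
have [n] : exists n : nat, U + V <= n%:R * d.
  exists (Num.truncn ((U + V) / d)).+1.
  by rewrite -ler_pdivrMr // ltW // truncnS_gt.
elim: n U V A a B b hU hV => [|n IH] U V A a B b /andP[U1 U2] /andP[V1 V2] hn hA hB.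
  by move: hn; rewrite mul0r; lra.
have [hU|hU] := lerP U 64.
  by apply: (fin _ _ A a B b U V) => //; apply: le_trans K0K _.
have [hV|hV] := lerP V 64.
  apply: lister_forces_sym.
  by apply: (fin _ _ B b A a V U) => //; apply: le_trans K0K _.
have [S [A1 [A2 [a1 [sS [sA1 ha1] sA2 pA1 pA2]]]]] :=
  push_or_kill (ltW hU) (ltW hV) Kge0 hK hA.
have [T [B1 [B2 [b1 [sT [sB1 hb1] sB2 pB1 pB2]]]]] :=
  push_or_kill (ltW hV) (ltW hU) Kge0 hK hB.
(* Both sides must move the parameters by the same amount, whence a symmetric [step]. *)
rewrite (stepC V U) in pB1 pB2.
have m0 : 0 < step U V := step_gt0 U1 V1.
have m1 : step U V <= 1 := step_le1 U1 V1.
have md : d <= step U V.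
  rewrite /d ler_pdivrMr ?exprn_gt0 //; apply: le_trans (step_ge U1 V1) _.
  by rewrite ler_pM2l // lerXn2r // nnegrE; lra.
have hn' : U + V - step U V <= n%:R * d.
  by move: hn; rewrite -natr1 mulrDl mul1r; lra.
apply: (ForceRound sS sT).
- apply: (@ForceWeaken _ _ _ _ _ _ A1 a1 B2 b) => //.
  apply: (IH (U - step U V) V) => //; [apply/andP; split; lra|by rewrite V1|].
  by rewrite addrAC.
- apply: (@ForceWeaken _ _ _ _ _ _ A2 a B1 b1) => //.
  apply: (IH U (V - step U V)) => //; [by rewrite U1|apply/andP; split; lra|].
  by rewrite addrA.
Qed.

(** From 1 + x <= e^x at x = 1 and x = -1/4. *)
Lemma expR4_bounds : 16 <= expR (4 : R) <= 162.
Proof.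
apply/andP; split.
  have -> : expR (4 : R) = expR 1 ^+ 4 by rewrite -expRM_natl mulr1.
  have : 2 <= expR (1 : R) by have := expR_ge1Dx (1 : R); lra.
  have -> : (16 : R) = 2 ^+ 4 by ring.
  by move=> h; apply: lerXn2r => //; rewrite nnegrE ?expR_ge0.
have -> : expR (4 : R) = (expR (- 4^-1) ^+ 16)^-1.
  by rewrite -expRM_natl -expRN; congr expR; field.
have h : 3 / 4 <= expR (- 4^-1 : R) by have := expR_ge1Dx (- 4^-1 : R); lra.
have h16 : (3 / 4 : R) ^+ 16 <= expR (- 4^-1) ^+ 16.
  by apply: lerXn2r => //; rewrite nnegrE ?expR_ge0 //; lra.
have c : 162^-1 <= (3 / 4 : R) ^+ 16 by lra.
rewrite -[leRHS]invrK lef_pV2 ?posrE ?exprn_gt0 ?expR_gt0 ?invr_gt0 //.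
exact: le_trans c h16.
Qed.

(** The two subtracted powers are at most e^-4 and e^4 times 2^-k, and 1 - 4/16 - 162/324 = 1/4. *)
Lemma wt_diag k : 63 <= k%:R :> R -> 4^-1 / 2 ^+ k <= wt (k%:R : R) k%:R k.
Proof.
move=> hk; have k0 : 0 < k%:R :> R by lra.
have kn0 : k%:R != 0 :> R by rewrite lt0r_neq0.
have ik := inv_le63 hk; have /andP[e16 e162] := expR4_bounds.
rewrite wtE //; have -> : k%:R / (k%:R + k%:R) = 2^-1 :> R.
  by rewrite -mulr2n -[k%:R *+ 2]mulr_natr invfM mulrA divff // mul1r.
have e4 (t : R) : k%:R * (t / k%:R) = t by rewrite mulrC divfK.
have h1 : (1 - 4 / k%:R : R) ^+ k <= 16^-1.
  apply: (@le_trans _ _ (expR (- (4 / k%:R)) ^+ k)).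
    apply: lerXn2r; rewrite ?nnegrE ?expR_ge0 //; first by lra.
    exact: expR_ge1Dx.
  by rewrite -expRM_natl mulrN e4 expRN lef_pV2 ?posrE ?expR_gt0.
have h2 : (1 + 4 / k%:R : R) ^+ k <= 162.
  apply: (@le_trans _ _ (expR (4 / k%:R) ^+ k)).
    by apply: lerXn2r; rewrite ?nnegrE ?expR_ge0 ?expR_ge1Dx.
  by rewrite -expRM_natl e4.
rewrite exprVn mulrC ler_pM2l ?invr_gt0 ?exprn_gt0 //.
by have := ik; lra.
Qed.

End Potential.

Lemma lister_forces_start (R : realType) : exists C : nat, forall k N : nat,
  (63 <= k)%N -> (C * 2 ^ k <= N)%N ->
  lister_forces [set: 'I_N] (fun=> k) [set: 'I_N] (fun=> k).
Proof.
have [K K0 force] := potential_forces R.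
exists (4 * (Num.truncn K).+1)%N => k N hk hN.
have hkR : 63 <= k%:R :> R by rewrite (ler_nat R 63).
have start : K <= \sum_(v in [set: 'I_N]) wt (k%:R : R) k%:R k.
  rewrite sumr_const cardsT card_ord.
  apply: (@le_trans _ _ ((4^-1 / 2 ^+ k) *+ N)); last by rewrite lerMn2r wt_diag ?orbT.
  have p0 : 0 < 2 ^+ k :> R by rewrite exprn_gt0.
  rewrite -mulr_natr mulrAC ler_pdivlMr // mulrC ler_pdivlMl //.
  move: hN; rewrite -(ler_nat R) !natrM natrX; apply: le_trans.
  rewrite -mulrA ler_pM2l // mulrC ler_pM2r //.
  exact/ltW/truncnS_gt.
by apply: (force _ _ k%:R k%:R k%:R) => //; rewrite hkR lexx.
Qed.

(** * The game on the complete bipartite graph *)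

Local Open Scope nat_scope.

Section Plays.
Variables (G : sgraph) (S : strategy G).
Implicit Types (V : {set G}) (Vs : seq {set G}) (v : G).

Lemma permissible_rcons Vs V v :
  permissible (rcons Vs V) v = permissible Vs v + (v \in V).
Proof. by rewrite /permissible -cats1 count_cat /= addn0. Qed.

Lemma lister_legal_extend Vs V : lister_legal S Vs -> V != finset.set0 ->
  V \subset ~: colored S Vs -> lister_legal S (rcons Vs V).
Proof.
move=> leg V0 sV i; rewrite size_rcons ltnS leq_eqVlt nth_rcons -cats1.
case/predU1P => [->|lti]; first by rewrite ltnn eqxx take_size_cat.
by rewrite lti takel_cat ?(ltnW lti) //; exact: leg.
Qed.

(** The winning condition only excludes equality with [k]; counts start at 0 and rise by at most one
    per round, so they never jump past [k]. *)
Lemma winning_permissible k Vs v : winning (fun=> k) S -> 0 < k ->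
  lister_legal S Vs -> v \notin colored S Vs -> permissible Vs v < k.
Proof.
move=> win k0; elim/last_ind: Vs => [//|Vs V IH] legV vN.
have [leg _ _] := lister_legal_rcons legV.
have [_ nwin] := win _ legV.
have lt : permissible Vs v < k.
  by apply: IH leg _; apply: contra vN => vc; rewrite colored_rcons finset.in_setU vc.
rewrite ltn_neqAle; apply/andP; split.
  apply/eqP => pk; apply: nwin; split; first by rewrite size_rcons.
  by exists v.
rewrite permissible_rcons; apply: leq_trans lt.
by rewrite -[leqRHS]addn1 leq_add2l leq_b1.
Qed.

Lemma painter_reply f Vs V : winning f S ->
  lister_legal S (rcons Vs V) ->
  S (rcons Vs V) \subset V /\ independent (S (rcons Vs V)).
Proof.
move=> win legV; have [pleg _] := win _ legV.
have := pleg (size Vs); rewrite size_rcons ltnSn => /(_ isT).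
by rewrite /reply nth_rcons ltnn eqxx -(size_rcons Vs V) take_size.
Qed.

End Plays.

Definition sides (m n : nat) (A : {set 'I_m}) (B : {set 'I_n}) :
    {set complete_bipartite m n} :=
  [set x : complete_bipartite m n |
    match x with inl i => i \in A | inr j => j \in B end].

Lemma lister_forces_sound m n k (S : strategy (complete_bipartite m n))
    (A : {set 'I_m}) a (B : {set 'I_n}) b Vs :
  lister_forces A a B b -> winning (fun=> k) S -> 0 < k -> lister_legal S Vs ->
  (forall i, i \in A ->
    inl i \notin colored S Vs /\ k <= permissible Vs (inl i) + a i) ->
  (forall j, j \in B ->
    inr j \notin colored S Vs /\ k <= permissible Vs (inr j) + b j) -> False.
Proof.
move=> + win k0; move=> force; elim: force Vs => {A a B b}.
- move=> A a B b v vA av Vs leg /(_ v vA) [vN]; rewrite av addn0 leqNgt.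
  by rewrite (winning_permissible win).
- move=> A a B b w wB bw Vs leg _ /(_ w wB) [wN]; rewrite bw addn0 leqNgt.
  by rewrite (winning_permissible win).
- move=> A a B b P Q sPA sQB _ IHl _ IHr Vs leg hA hB.
  (* Lister may not present an empty set; such a round changes nothing and is skipped. *)
  have [V0|Vn0] := eqVneq (sides P Q) finset.set0.
    have P0 i : i \in P = false.
      by have /setP/(_ (inl i)) := V0; rewrite !inE.
    have Q0 j : j \in Q = false.
      by have /setP/(_ (inr j)) := V0; rewrite !inE.
    apply: (IHl Vs leg) => [i /hA|j].
      by rewrite /push P0.
    by rewrite inE => /andP[_ /hB].
  have sV : sides P Q \subset ~: colored S Vs.
    apply/fintype.subsetP => -[i|j]; rewrite !inE.
      by move=> /(fintype.subsetP sPA) /hA [].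
    by move=> /(fintype.subsetP sQB) /hB [].
  have legV := lister_legal_extend leg Vn0 sV.
  have [sX iX] := painter_reply win legV.
  set V := sides P Q in sV legV sX iX *; set X := S _ in sX iX.
  have keep x : x \notin colored S Vs -> x \notin X -> x \notin colored S (rcons Vs V).
    by move=> xc xX; rewrite colored_rcons finset.in_setU negb_or xc.
  have inV x : x \notin V -> x \notin X by apply: contra => /(fintype.subsetP sX).
  (* An independent set of a complete bipartite graph meets only one side. An empty reply falls
     under the second case. *)
  have [/existsP[i0 i0X]|noL] := boolP [exists i, inl i \in X].
    apply: (IHr _ legV) => [i|j jB].
      rewrite inE => /andP[iP /hA [iN ki]]; split; last first.
        by rewrite permissible_rcons addnAC; apply: leq_trans ki (leq_addr _ _).
      by apply: keep => //; apply: inV; rewrite inE.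
    have [jN kj] := hB j jB; split.
      by apply: keep => //; apply/negP => /(iX _ _ i0X).
    by move: kj; rewrite permissible_rcons /push inE; case: (j \in Q) => /=; lia.
  have noL' i : inl i \notin X by apply: contra noL => iX'; apply/existsP; exists i.
  apply: (IHl _ legV) => [i iA|j].
    have [iN ki] := hA i iA; split; first exact: keep.
    by move: ki; rewrite permissible_rcons /push inE; case: (i \in P) => /=; lia.
  rewrite inE => /andP[jQ /hB [jN kj]]; split; last first.
    by rewrite permissible_rcons addnAC; apply: leq_trans kj (leq_addr _ _).
  by apply: keep => //; apply: inV; rewrite inE.
- move=> A a B b A' a' B' b' sA sB la lb _ IH Vs leg hA hB.
  apply: (IH Vs leg) => [i iA'|j jB'].
    have [iN ki] := hA i (fintype.subsetP sA i iA'); split=> //.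
    by apply: leq_trans ki _; rewrite leq_add2l la.
  have [jN kj] := hB j (fintype.subsetP sB j jB'); split=> //.
  by apply: leq_trans kj _; rewrite leq_add2l lb.
Qed.

(** Lister presents [v] alone, and [u] stays uncolored with 0 permissible colors after a round. This
    settles k = 0, which [lister_forces_sound] excludes. *)
Lemma not_paintable0 (G : sgraph) (u v : G) : u != v -> ~ paintable G 0.
Proof.
move=> uv [S win]; have leg : lister_legal S (rcons [::] [set v]%SET).
  apply: lister_legal_extend => //; first by apply/set0Pn; exists v; rewrite inE.
  by apply/fintype.subsetP => x _; rewrite inE /colored big_ord0 inE.
have [sX _] := painter_reply win leg.
have [_ nwin] := win _ leg; apply: nwin; split=> //; exists u.
  rewrite colored_rcons finset.in_setU /colored big_ord0 finset.in_set0 /=.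
  by apply: contra uv => /(fintype.subsetP sX); rewrite inE.
by rewrite permissible_rcons inE (negPf uv).
Qed.

Lemma paintable_lower (R : realType) : exists C : nat, forall k N : nat,
  paintable (complete_bipartite N N) k -> N < C * 2 ^ k.
Proof.
have [C force] := lister_forces_start R.
(* The factor 2^63 allows starting with label 63 + k, an upper bound for the [k] colors really
   lacking, so small [k] needs no separate argument. [C.+1] ensures that [N] is positive. *)
exists (C.+1 * 2 ^ 63) => k N pk; rewrite ltnNge; apply/negP => hN.
have N0 : 0 < N by apply: leq_trans hN; rewrite !muln_gt0 !expn_gt0.
case: (posnP k) => [k0|k0].
  have uv : inl (Ordinal N0) != inr (Ordinal N0) :> complete_bipartite N N by [].
  by apply: (not_paintable0 uv); rewrite -k0.
case: pk => S win; have hC : C * 2 ^ (63 + k) <= N.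
  by apply: leq_trans hN; rewrite expnD mulnA !leq_mul2r leqnSn !orbT.
apply: (lister_forces_sound (Vs := [::]) (force _ _ (leq_addr k 63) hC) win k0) => //.
- by move=> i _; rewrite /colored big_ord0 finset.in_set0 addnA leq_addl.
- by move=> i _; rewrite /colored big_ord0 finset.in_set0 addnA leq_addl.
Qed.

(** * Painter's strategy and the upper bound *)

Definition potential (G : sgraph) (S : strategy G) (Vs : seq {set G}) : nat :=
  \sum_(x in ~: colored S Vs) 2 ^ permissible Vs x.

Definition left_side (N : nat) : {set complete_bipartite N N} :=
  [set x : complete_bipartite N N | if x is inl _ then true else false]%SET.

(** [Vs] includes the current move, which doubles all weights on the presented set and leaves the
    comparison unchanged. *)
Definition heavier_side (N : nat) : strategy (complete_bipartite N N) := fun Vs =>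
  let V := last finset.set0 Vs in let L := V :&: left_side N in
  if \sum_(x in V :\: L) 2 ^ permissible Vs x <= \sum_(x in L) 2 ^ permissible Vs x
  then L else V :\: L.

Lemma heavier_side_legal N Vs (V : {set complete_bipartite N N})
    (X := heavier_side (rcons Vs V)) :
  [/\ X \subset V, independent X &
    \sum_(x in V :\: X) 2 ^ permissible (rcons Vs V) x
      <= \sum_(x in X) 2 ^ permissible (rcons Vs V) x].
Proof.
rewrite /X /heavier_side last_rcons; set L := V :&: _.
case: leqP => h; split=> //.
- exact: finset.subsetIl.
- by move=> [i|i] [j|j]; rewrite !inE ?andbF.
- exact: finset.subsetDl.
- by move=> [i|i] [j|j]; rewrite !inE ?andbT ?andbF ?andNb.
- have -> : V :\: (V :\: L) = L.
    by apply/setP => x; rewrite !inE; case: (x \in V); rewrite ?andbF //= ?andbT negbK.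
  exact: ltnW.
Qed.

(** Presenting a set doubles its weight, and coloring its heavier side removes at least half of the
    doubled weight. *)
Lemma heavier_side_potential N Vs : lister_legal (@heavier_side N) Vs ->
  potential (@heavier_side N) Vs <= 2 * N.
Proof.
elim/last_ind: Vs => [_|Vs V IH legV].
  rewrite /potential /colored big_ord0 finset.setC0 sum1_card finset.cardsT.
  by rewrite card_sum card_ord addnn mul2n.
have [leg _ sV] := lister_legal_rcons legV; apply: leq_trans (IH leg).
have [sX _] := heavier_side_legal Vs V.
rewrite /potential colored_rcons; set X := heavier_side _ in sX *.
set C := colored _ _ in sV *; move=> le_w.
have dbl x : x \in V -> 2 ^ permissible (rcons Vs V) x = 2 * 2 ^ permissible Vs x.
  by move=> xV; rewrite permissible_rcons xV addn1 expnS.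
rewrite (big_setID V) /= [leqRHS](big_setID V) /=.
have -> : ~: (C :|: X) :&: V = V :\: X.
  apply/setP => x; rewrite !inE; case: (boolP (x \in V)) => [xV|]; rewrite ?andbF //.
  by have := fintype.subsetP sV x xV; rewrite inE => /negPf ->; rewrite /= !andbT.
have -> : ~: C :&: V = V by apply/finset.setIidPr.
apply: leq_add; last first.
  have -> : ~: (C :|: X) :\: V = ~: C :\: V.
    apply/setP => x; rewrite !inE; case: (boolP (x \in V)) => //= xV.
    suff /negPf -> : x \notin X by rewrite orbF.
    by apply: contra xV => /(fintype.subsetP sX).
  apply: leq_sum => x; rewrite inE => /andP[/negPf xV _].
  by rewrite permissible_rcons xV addn0.
have split_V : \sum_(x in V) 2 ^ permissible (rcons Vs V) x =
    \sum_(x in X) 2 ^ permissible (rcons Vs V) x +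
    \sum_(x in V :\: X) 2 ^ permissible (rcons Vs V) x.
  by rewrite (big_setID X) /= (finset.setIidPr sX).
have : \sum_(x in V) 2 ^ permissible (rcons Vs V) x =
    2 * \sum_(x in V) 2 ^ permissible Vs x.
  by rewrite big_distrr; apply: eq_bigr => x; exact: dbl.
by rewrite split_V => h; rewrite -(leq_pmul2l (isT : 0 < 2)) -h mul2n -addnn leq_add2r.
Qed.

Lemma paintable_upper N k : 2 * N < 2 ^ k -> paintable (complete_bipartite N N) k.
Proof.
move=> hk; exists (@heavier_side N) => Vs leg; split=> [i lti|]; last first.
  case=> _ [v vN pv]; move: hk; rewrite ltnNge => /negP; apply.
  apply: leq_trans (heavier_side_potential leg).
  by rewrite /potential (bigD1 v) ?inE //= pv leq_addr.
rewrite /reply (take_nth finset.set0) //.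
by have [] := heavier_side_legal (take i Vs) (nth finset.set0 Vs i).
Qed.

(** * The asymptotic statement *)

Local Open Scope classical_set_scope.
Local Open Scope ring_scope.

Theorem theorem1 (R : realType) :
  (fun N : nat => (pnt (complete_bipartite N N))%:R : R) =
    (fun N : nat => ln (N%:R : R) / ln (2 : R)) +O_\oo (fun _ : nat => 1 : R).
Proof.
have [C lower] := paintable_lower R.
have l2 : 0 < ln (2 : R) by rewrite ln_gt0 // ltr1n.
(* The paint number exceeds log N by at most 2 and falls short of it by at most log C. *)
pose M : R := 2 + `|ln (C%:R : R) / ln 2|.
apply/eqaddOP; near=> K; near=> N.
have MK : M <= K by near: K; apply: nbhs_pinfty_ge; exact: num_real.
have N0 : (0 < N)%N by near: N; exact: nbhs_infty_gt.
rewrite normr1 mulr1; apply: le_trans MK.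
change (`|(pnt (complete_bipartite N N))%:R - ln N%:R / ln 2 : R| <= M).
rewrite /pnt; case: ex_minnP => p /asboolP pp pmin.
have NR : 0 < N%:R :> R by rewrite ltr0n.
have up : p%:R <= ln (N%:R : R) / ln 2 + 2.
  have t0 : (p <= (trunc_log 2 (2 * N)).+1)%N.
    by apply: pmin; apply/asboolP/paintable_upper; exact: trunc_log_ltn.
  have t1 : (2 ^ trunc_log 2 (2 * N) <= 2 * N)%N by rewrite trunc_logP ?muln_gt0.
  set t := trunc_log _ _ in t0 t1.
  have tl : t%:R * ln (2 : R) <= ln 2 + ln N%:R.
    rewrite -lnM ?posrE // mulr_natl -lnXn // ler_ln ?posrE ?mulr_gt0 ?exprn_gt0 //.
    by rewrite -natrX -natrM ler_nat.
  have {}t0 : p%:R <= t%:R + 1 :> R by rewrite natr1 ler_nat.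
  apply: (le_trans t0); have -> : (2 : R) = 1 + 1 by []. 
  by rewrite addrA lerD2r -(ler_pM2r l2) mulrDl mul1r divfK ?lt0r_neq0 // addrC.
have lo : ln (N%:R : R) / ln 2 <= ln C%:R / ln 2 + p%:R.
  have NC := lower p N pp.
  have C0 : (0 < C)%N by move: NC; case: (C) => //; rewrite mul0n.
  have CR : 0 < C%:R :> R by rewrite ltr0n.
  rewrite -(ler_pM2r l2) mulrDl !divfK ?lt0r_neq0 // mulr_natl -lnXn //.
  rewrite -lnM ?posrE ?exprn_gt0 // ler_ln ?posrE ?mulr_gt0 ?exprn_gt0 //.
  by rewrite -natrX -natrM ler_nat ltnW.
have := ler_norm (ln C%:R / ln (2 : R)).
have := normr_ge0 (ln C%:R / ln (2 : R)).
rewrite ler_norml /M.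
by move=> ? ?; apply/andP; split; lra.
Unshelve. all: by end_near.
Qed.
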